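(* Let $D$ be a digraph on $\{1,\dots,n\}$ (as in the context), and let $\Delta_D$ be the subgraph of $D$ obtained by removing every edge connecting vertices $i$ and $j$ (from $i$ to $j$) with $\langle i,j\rangle=1$. If $D$ is invertible, then $\Delta_D$ is bipartite.
   Context: Digraphs $D$ are finite, with vertex set $\{1,\dots,n\}$, may have multiple edges but no loops, and every directed edge $i\to j$ satisfies $i<j$. Let $B=B_D$ be the $n\times n$ upper unitriangular integer matrix with $B_{i,i}=1$ and $B_{i,j}$ equal to the number of edges from $i$ to $j$ for $i\ne j$. $D$ is invertible if there is a diagonal matrix $S$ with diagonal entries in $\{\pm1\}$ such that $SB^{-1}S=|B^{-1}|$, where $|\cdot|$ is the componentwise absolute value. For vertices $i,j$ set $\langle i,j\rangle=(-1)^{\ell}$, where $\ell$ is the maximal length of a directed path from $i$ to $j$ in $D$, and $\langle i,j\rangle=0$ if there is no such path. A digraph is called bipartite if its underlying undirected graph is. *)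

(* Defs.v *)
From HB Require Import structures.
From mathcomp Require Import all_boot all_order all_algebra.

Set Implicit Arguments.
Unset Strict Implicit.
Unset Printing Implicit Defensive.

Import Order.TTheory GRing.Theory Num.Theory.

Local Open Scope ring_scope.

(* The vertices 1, ..., n are represented by 'I_n, i.e. by 0, ..., n - 1; a
   multigraph is given by its edge multiplicities. *)
Record digraph (n : nat) := Digraph {
  mult : 'I_n -> 'I_n -> nat;
  mult_lt : forall i j : 'I_n, (0 < mult i j)%N -> (i < j)%N
}.

Definition edge n (D : digraph n) : rel 'I_n := fun i j => (0 < mult D i j)%N.

Definition digraph_mx n (D : digraph n) : 'M[int]_n :=
  \matrix_(i, j) if i == j then 1 else (mult D i j)%:Z.

Lemma digraph_mx_unit n (D : digraph n) : digraph_mx D \in unitmx.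
Proof.
rewrite unitmxE -det_tr det_trig.
  by rewrite big1 ?unitr1 // => i _; rewrite !mxE eqxx.
apply/is_trig_mxP => i j lt_ij; rewrite !mxE.
have [eq_ji|_] := eqVneq j i; first by rewrite eq_ji ltnn in lt_ij.
case E: (mult D j i) => [//|m].
have lt_ji : (j < i)%N by apply: (mult_lt (d := D)); rewrite E.
by have := ltn_trans lt_ij lt_ji; rewrite ltnn.
Qed.

Definition invertible n (D : digraph n) : Prop :=
  exists s : 'rV[int]_n,
    (forall i, s 0 i = 1 \/ s 0 i = -1) /\
    diag_mx s *m invmx (digraph_mx D) *m diag_mx s
      = map_mx (fun x : int => `|x|) (invmx (digraph_mx D)).

(* i :: p is a directed path from i to j; its length is [size p], and the
   trivial path from i to i has length 0. *)
Definition dipath n (D : digraph n) (i j : 'I_n) (p : seq 'I_n) : bool :=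
  path (edge D) i p && (last i p == j).

(* This justifies the bound l < n in the two definitions that follow it. *)
Lemma size_dipath n (D : digraph n) (i j : 'I_n) (p : seq 'I_n) :
  dipath D i j p -> (size p < n)%N.
Proof.
case/andP=> Dp _; suff : uniq (i :: p).
  by move/card_uniqP => /= <-; rewrite -[X in (_ <= X)%N]card_ord max_card.
have lt_irr : irreflexive (fun a b : 'I_n => a < b)%N by move=> a; rewrite ltnn.
have lt_tr : transitive (fun a b : 'I_n => a < b)%N.
  by move=> b a c; apply: ltn_trans.
apply: (sorted_uniq lt_tr lt_irr) => /=.
by apply: sub_path Dp => a b; apply: mult_lt.
Qed.

Definition has_dipath n (D : digraph n) (i j : 'I_n) (l : nat) : bool :=
  [exists p : l.-tuple 'I_n, dipath D i j p].

Definition max_dipath n (D : digraph n) (i j : 'I_n) : nat :=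
  \max_(l < n | has_dipath D i j l) l.

Definition bracket n (D : digraph n) (i j : 'I_n) : int :=
  if [exists l : 'I_n, has_dipath D i j l] then (-1) ^+ max_dipath D i j else 0.

Definition Delta_mult n (D : digraph n) (i j : 'I_n) : nat :=
  if bracket D i j == 1 then 0%N else mult D i j.

Lemma Delta_mult_lt n (D : digraph n) (i j : 'I_n) :
  (0 < Delta_mult D i j)%N -> (i < j)%N.
Proof. by rewrite /Delta_mult; case: ifP => // _; apply: mult_lt. Qed.

Definition Delta n (D : digraph n) : digraph n :=
  Digraph (@Delta_mult_lt n D).

Definition adjacent n (D : digraph n) : rel 'I_n :=
  fun i j => edge D i j || edge D j i.

Definition bipartite n (D : digraph n) : Prop :=
  exists A : {set 'I_n},
    forall i j : 'I_n, adjacent D i j -> (i \in A) != (j \in A).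

(* Main.v *)
Require Import Defs.
From mathcomp Require Import all_boot all_order all_algebra.

Set Implicit Arguments.
Unset Strict Implicit.
Unset Printing Implicit Defensive.

Import GRing.Theory Num.Theory.

Local Open Scope ring_scope.

(** The signs [s] witnessing invertibility satisfy
    [s i * s j = bracket D i j] whenever [D] has a directed path from [i] to
    [j]; hence they 2-colour [Delta D], whose edges have bracket [-1].

    Write [C] for the inverse of [B]. The entry [C i j] is a signed count of
    the directed paths from [i] to [j], so when the edges from [i] to [j] are
    the only such paths, [C i j] is minus their number, and invertibility
    forces [s i * s j = -1] ([sign_cover]). In a longest path from [i] to [j]
    every step is of this kind, since a detour around a step would lengthen
    the path. Multiplying along the path gives [(-1) ^+ l], where [l] is its
    length ([sign_longest]). *)

Section Inverse.

Variables (n : nat) (D : digraph n).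

Let C := invmx (digraph_mx D).

Lemma dipath_cat i j k p q :
  dipath D i k p -> dipath D k j q -> dipath D i j (p ++ q).
Proof.
case/andP=> Dp /eqP lp /andP[Dq lq].
by rewrite /dipath cat_path last_cat lp Dp Dq.
Qed.

Lemma dipath_leq i j p : dipath D i j p -> (i <= j)%N.
Proof.
elim: p i => [|k p IHp] i /=; first by case/andP=> _ /eqP /= ->.
case/andP=> /= /andP[/mult_lt lt_ik Dp] lp.
by apply: leq_trans (ltnW lt_ik) (IHp k _); rewrite /dipath Dp.
Qed.

Lemma invmx_digraphE i j :
  C i j = (i == j)%:R - \sum_(k | k != i) (mult D i k)%:Z * C k j.
Proof.
have /matrixP/(_ i j) := mulmxV (digraph_mx_unit D).
rewrite !mxE (bigD1 i) //= mxE eqxx mul1r => <-.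
rewrite (eq_bigr (fun k => (mult D i k)%:Z * C k j)) ?addrK // => k ne_ki.
by rewrite mxE eq_sym (negPf ne_ki).
Qed.

(** All that is needed of the expansion of the inverse as a signed sum over
    directed paths is where it can be nonzero. *)
Lemma invmx_digraph_neq0 i j : C i j != 0 -> exists p, dipath D i j p.
Proof.
(* The recurrence expresses row i through the rows k > i. *)
have [m] := ubnP (n - i); elim: m i => // m IHm i le_im.
have [<- _|ne_ij] := eqVneq i j; first by exists [::]; rewrite /dipath /=.
rewrite invmx_digraphE (negPf ne_ij) sub0r oppr_eq0 => nz.
have [k Pk|zero] := pickP (fun k => (mult D i k)%:Z * C k j != 0); last first.
  by rewrite big1 ?eqxx // in nz => k _; apply/eqP; rewrite -[_ == _]negbK zero.
move: Pk; rewrite mulf_eq0 negb_or => /andP[ik nzC].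
have {}ik : edge D i k by rewrite /edge lt0n; apply: contraNneq ik => ->.
have [|p Dp] := IHm k _ nzC.
  apply: leq_trans (ltn_sub2l (ltn_ord i) (mult_lt ik)) _.
  by rewrite -ltnS.
exists (k :: p); apply: (@dipath_cat _ _ k [:: k] p) => //.
by rewrite /dipath /= ik eqxx.
Qed.

Lemma invmx_digraph_diag j : C j j = 1.
Proof.
rewrite invmx_digraphE eqxx big1 ?subr0 // => k _.
have [->|] := posnP (mult D j k); first by rewrite mul0r.
move/mult_lt=> lt_jk; have [->|] := eqVneq (C k j) 0; first by rewrite mulr0.
by case/invmx_digraph_neq0=> p /dipath_leq; rewrite leqNgt lt_jk.
Qed.

Lemma invmx_digraph_cover i j :
  edge D i j -> (forall p, dipath D i j p -> (size p <= 1)%N) ->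
  C i j = - (mult D i j)%:Z.
Proof.
move=> ij cover; have lt_ij := mult_lt ij.
have ne_ji : j != i by rewrite -(inj_eq val_inj) gtn_eqF.
rewrite invmx_digraphE eq_sym (negPf ne_ji) sub0r (bigD1 j) //=.
(* Any other nonzero term would give a directed path through k != i, j. *)
rewrite invmx_digraph_diag mulr1 big1 ?addr0 // => k /andP[_ ne_kj].
have [->|ik] := posnP (mult D i k); first by rewrite mul0r.
have [->|] := eqVneq (C k j) 0; first by rewrite mulr0.
case/invmx_digraph_neq0=> -[|x p] Dp; first by case/andP: Dp; rewrite (negPf ne_kj).
have /cover // : dipath D i j ([:: k] ++ x :: p).
by apply: dipath_cat Dp; rewrite /dipath /= /edge ik eqxx.
Qed.

End Inverse.

Section Signs.

Variables (n : nat) (D : digraph n) (s : 'rV[int]_n).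

Hypothesis s_pm1 : forall i, s 0 i = 1 \/ s 0 i = -1.
Hypothesis s_inv :
  diag_mx s *m invmx (digraph_mx D) *m diag_mx s
    = map_mx (fun x : int => `|x|) (invmx (digraph_mx D)).

Lemma sign_cover i j :
  edge D i j -> (forall p, dipath D i j p -> (size p <= 1)%N) ->
  s 0 i * s 0 j = -1.
Proof.
move=> ij cover; have /matrixP/(_ i j) := s_inv.
rewrite mul_diag_mx mul_mx_diag !mxE invmx_digraph_cover //.
rewrite /edge in ij; rewrite normrN.
by case: (mult D i j) ij => // m _; case: (s_pm1 i) => ->;
  case: (s_pm1 j) => ->; rewrite ?mulr1 ?mul1r ?mulrN1 ?mulN1r ?opprK.
Qed.

(** A longer path between two vertices of a longest path could be spliced in,
    so both the first step and the remainder of a longest path are again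
    longest paths between their ends. *)
Lemma sign_longest i j p :
  dipath D i j p -> (forall q, dipath D i j q -> (size q <= size p)%N) ->
  s 0 i * s 0 j = (-1) ^+ size p.
Proof.
elim: p i => [|k p IHp] i.
  by case/andP=> _ /eqP /= -> _; case: (s_pm1 j) => ->; rewrite ?mulrNN mulr1.
case/andP=> /= /andP[ik Dp] lp longest.
have Dkj : dipath D k j p by rewrite /dipath Dp.
have Dik : dipath D i k [:: k] by rewrite /dipath /= ik eqxx.
have sik : s 0 i * s 0 k = -1.
  apply: sign_cover => // q Dq.
  by have := longest _ (dipath_cat Dq Dkj); rewrite size_cat -add1n leq_add2r.
have skj : s 0 k * s 0 j = (-1) ^+ size p.
  by apply: IHp => // q Dq; have := longest _ (dipath_cat Dik Dq).
have skk : s 0 k * s 0 k = 1 by case: (s_pm1 k) => ->; rewrite ?mulrNN mulr1.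
by rewrite exprS -skj -sik mulrA -(mulrA (s 0 i)) skk mulr1.
Qed.

Lemma sign_bracket i j p : dipath D i j p -> s 0 i * s 0 j = bracket D i j.
Proof.
have lenP q (Dq : dipath D i j q) : has_dipath D i j (Ordinal (size_dipath Dq)).
  by apply/existsP; exists (in_tuple q).
move=> Dp; have hasP := lenP p Dp.
rewrite /bracket; case: existsP => [_|[]]; last by exists (Ordinal (size_dipath Dp)).
have [|l /existsP[q Dq] maxE] :=
  @eq_bigmax_cond _ [pred l : 'I_n | has_dipath D i j l] (fun l => l : nat).
  by apply/card_gt0P; exists (Ordinal (size_dipath Dp)).
have -> : max_dipath D i j = size q by rewrite size_tuple -maxE.
apply: sign_longest Dq _ => r Dr; rewrite size_tuple -maxE.
exact: (@leq_bigmax_cond _ _ (fun l : 'I_n => l : nat) _ (lenP r Dr)).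
Qed.

Lemma sign_Delta i j : edge (Delta D) i j -> s 0 i * s 0 j = -1.
Proof.
rewrite /edge /= /Delta_mult; case: ifPn => // br_ne1 ij.
have := @sign_bracket i j [:: j]; rewrite /dipath /= /edge ij eqxx => /(_ isT) sE.
move: br_ne1; rewrite -sE.
by case: (s_pm1 i) => ->; case: (s_pm1 j) => ->.
Qed.

End Signs.

Theorem theorem3p27 (n : nat) (D : digraph n) :
  invertible D -> bipartite (Delta D).
Proof.
case=> s [s_pm1 s_inv]; exists [set i | s 0 i == 1].
have colour i j : edge (Delta D) i j -> (s 0 i == 1) != (s 0 j == 1).
  move/(sign_Delta s_pm1 s_inv).
  by case: (s_pm1 i) => ->; case: (s_pm1 j) => ->.
move=> i j; rewrite !inE => /orP[/colour //|/colour].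
by rewrite eq_sym.
Qed.
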